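(* Let $H\in(0,1)$ and $(a,b)\in\mathbb{R}^2\setminus\{(0,0)\}$, let $(Z_t^H)_{t\ge 0}=(Z_t^H(a,b))_{t\ge0}$ be the generalized fractional Brownian motion with parameters $a,b,H$, and for integers $p\ge1$, $n\ge1$ put $$R_Z(p,p+n)=\mathbb{E}\bigl((Z_{p+1}^H-Z_p^H)(Z_{p+n+1}^H-Z_{p+n}^H)\bigr),\qquad R_B(0,n)=\tfrac12\bigl[(n+1)^{2H}-2n^{2H}+(n-1)^{2H}\bigr].$$ Then for every integer $n\ge1$, as $p\to\infty$, $$R_Z(p,p+n)=(a^2+b^2)R_B(0,n)-ab\,\bigl(2^{2H-1}H(2H-1)\bigr)\,p^{2(H-1)}\,(1+o(1)),$$ and, consequently, $$\lim_{p\to\infty}R_Z(p,p+n)=(a^2+b^2)R_B(0,n).$$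
   Context: For $H\in(0,1)$, a two-sided fractional Brownian motion with Hurst parameter $H$ is a centered Gaussian process $B^H=(B_t^H)_{t\in\mathbb{R}}$ on a probability space $(\Omega,F,\mathbb{P})$ with covariance $\operatorname{Cov}(B_t^H,B_s^H)=\frac12\bigl(|s|^{2H}+|t|^{2H}-|t-s|^{2H}\bigr)$ for $s,t\in\mathbb{R}$. For real $a,b$ with $(a,b)\ne(0,0)$, the generalized fractional Brownian motion (gfBm) with parameters $a,b,H$ is the process $Z^H=(Z_t^H)_{t\ge0}$ defined by $Z_t^H=Z_t^H(a,b)=aB_t^H+bB_{-t}^H$ for $t\ge 0$. The quantity $R_B(0,n)$ equals $\mathbb{E}\bigl((B_{p+1}^H-B_p^H)(B_{p+n+1}^H-B_{p+n}^H)\bigr)$, which does not depend on $p$. The $o(1)$ is as $p\to\infty$ with $n,a,b,H$ fixed. *)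

(* Defs.v *)
From HB Require Import structures.
From mathcomp Require Import all_boot all_order all_algebra.
From mathcomp Require Import all_classical all_reals all_analysis.

Set Implicit Arguments.
Unset Strict Implicit.
Unset Printing Implicit Defensive.

Import Order.TTheory GRing.Theory Num.Theory.
Import numFieldNormedType.Exports.

Local Open Scope classical_set_scope.
Local Open Scope ring_scope.

Section fractional_brownian_motion.
Context d (T : measurableType d) (R : realType) (P : probability T R).

(* The degenerate law is handled separately because [normal_prob m 0] is, by
   the library's convention, the uniform law on [0, 1] and not [\d_m]. *)
Definition gaussian_law (m s : R) : set R -> \bar R :=
  if s == 0 then \d_m else normal_prob m s.

Definition gaussian_variable (X : T -> R) : Prop :=
  exists m s : R, forall A : set R, measurable A ->
    pushforward P X A = gaussian_law m s A.

Definition gaussian_process (I : Type) (X : I -> {RV P >-> R}) : Prop :=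
  forall (k : nat) (t : 'I_k -> I) (c : 'I_k -> R),
    gaussian_variable (fun w => \sum_(i < k) c i * X (t i) w).

Record fractional_brownian_motion (H : R) (B : R -> {RV P >-> R}) : Prop := {
  fbm_gaussian : gaussian_process B ;
  fbm_centered : forall t : R, ('E_P[B t] = 0)%E ;
  fbm_covariance : forall t s : R, covariance P (B t) (B s) =
    (2^-1 * (`|s| `^ (2 * H) + `|t| `^ (2 * H) - `|t - s| `^ (2 * H)))%:E
}.

Definition gfbm (a b : R) (B : R -> {RV P >-> R}) (t : {nonneg R}) : T -> R :=
  fun w => a * B t%:num w + b * B (- t%:num) w.

Definition increment (Z : {nonneg R} -> T -> R) (p : nat) : T -> R :=
  fun w => Z (p.+1%:R)%:nng w - Z (p%:R)%:nng w.

(* Extended-real valued, as is ['E_P[_]]: an equation with a right-hand side in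
   [R] also asserts that the expectation is finite. *)
Definition R_Z (Z : {nonneg R} -> T -> R) (p q : nat) : \bar R :=
  ('E_P[(increment Z p \* increment Z q)%R])%E.

End fractional_brownian_motion.

(* For n = 1 the last term is [0 `^ (2 * H)], which is 0 as soon as H != 0. *)
Definition R_B (R : realType) (H : R) (n : nat) : R :=
  2^-1 * ((n%:R + 1) `^ (2 * H) - 2 * n%:R `^ (2 * H) + (n%:R - 1) `^ (2 * H)).

(* Main.v *)
(* The increments of [B] are stationary, so expanding
     E[(a D_p + b D'_p) (a D_(p+n) + b D'_(p+n))],
   with D_p = B_(p+1) - B_p and D'_p = B_(-p-1) - B_(-p), gives the constant
   (a^2 + b^2) R_B(0, n) and two cross terms, which together equal
   - a b times the second difference with unit step of x^(2H) at 2p + n.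
   By the mean value theorem, applied twice, this second difference is
   2H (2H - 1) c^(2H - 2) for some c in ]2p + n, 2p + n + 2[, and c / (2p)
   tends to 1. The term eps p = (c / (2p))^(2H - 2) - 1 is thus defined even
   when the coefficient a b (2H - 1) vanishes. *)
Require Import Defs.
From HB Require Import structures.
From mathcomp Require Import all_boot all_order all_algebra.
From mathcomp Require Import all_classical all_reals all_analysis.
From mathcomp Require Import ring lra.

Set Implicit Arguments.
Unset Strict Implicit.
Unset Printing Implicit Defensive.

Import Order.TTheory GRing.Theory Num.Theory.
Import numFieldNormedType.Exports.

Local Open Scope classical_set_scope.
Local Open Scope ring_scope.

(** * Expectations of products of linear combinations *)

Section mean.
Context d (T : measurableType d) (R : realType) (P : probability T R).

(** Integrability travels with the value because linearity of the expectation asks for it. *)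
Definition has_mean (f : T -> R) (m : R) : Prop :=
  P.-integrable setT (EFin \o f) /\ ('E_P[f] = m%:E)%E.

Lemma has_meanD (f g : T -> R) (m m' : R) :
  has_mean f m -> has_mean g m' -> has_mean (f \+ g) (m + m').
Proof.
move=> [intf Ef] [intg Eg]; split.
  exact: (integrableD measurableT intf intg).
by rewrite expectationD ?Ef ?Eg//; exact/Lfun1_integrable.
Qed.

Lemma has_meanZ (c : R) (f : T -> R) (m : R) :
  has_mean f m -> has_mean (fun w => c * f w) (c * m).
Proof.
move=> [intf Ef]; split.
  exact: (integrableZl measurableT c intf).
rewrite (_ : (fun w => c * f w) = c \o* f)%R; last first.
  by apply/funext => w /=; rewrite mulrC.
by rewrite expectationZl ?Ef//; exact/Lfun1_integrable.
Qed.

(** Used with coefficients [1], [-1] to pass from values of [B] to its increments, then with [a],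
    [- b] to pass to the increments of [gfbm]. *)
Lemma has_mean_mul_lincomb (X X' Y Y' : T -> R) (c c' e e' m1 m2 m3 m4 : R) :
  has_mean (X \* Y) m1 -> has_mean (X \* Y') m2 ->
  has_mean (X' \* Y) m3 -> has_mean (X' \* Y') m4 ->
  has_mean (fun w => (c * X w + c' * X' w) * (e * Y w + e' * Y' w))
    (c * e * m1 + c * e' * m2 + c' * e * m3 + c' * e' * m4).
Proof.
move=> XY XY' X'Y X'Y'.
have := has_meanD (has_meanD (has_meanD (has_meanZ (c * e) XY)
  (has_meanZ (c * e') XY')) (has_meanZ (c' * e) X'Y))
  (has_meanZ (c' * e') X'Y').
by congr has_mean; apply/funext => w /=; ring.
Qed.

Lemma Lfun2_sqr_lty (X : {RV P >-> R}) :
  ('E_P[X \* X] < +oo)%E -> (X : T -> R) \in Lfun P 2%:E.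
Proof.
move=> EX; apply/andP; rewrite !inE/=; split; first exact: measurable_funPT.
rewrite /finite_norm unlock poweR_lty//.
rewrite [ltLHS](_ : _ = 'E_P[X \* X])%E// expectation.unlock.
by apply: eq_integral => w _ /=; rewrite powR_mulrn// real_normK ?num_real.
Qed.

End mean.

(** * Covariances of the increments of [B] and of [gfbm] *)

Section fbm_increments.
Context d (T : measurableType d) (R : realType) (P : probability T R).
Variables (H : R) (B : R -> {RV P >-> R}).
Hypothesis fbmB : fractional_brownian_motion H B.

Let k (t s : R) : R :=
  2^-1 * (`|s| `^ (2 * H) + `|t| `^ (2 * H) - `|t - s| `^ (2 * H)).

(* Square integrability is read off the finite variance. *)
Lemma fbm_has_mean_mul (t s : R) : has_mean P (B t \* B s) (k t s).
Proof.
have EB u v : ('E_P[B u \* B v] = (k u v)%:E)%E.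
  rewrite -(fbm_covariance fbmB) [in RHS]unlock !(fbm_centered fbmB)/=.
  congr expectation; apply/funext => w /=.
  by rewrite -[B u w in LHS]subr0 -[B v w in LHS]subr0.
split=> //; apply/Lfun1_integrable/Lfun2_mul_Lfun1;
  by apply: Lfun2_sqr_lty; rewrite EB ltry.
Qed.

(** In the four values of [k] the powers of a single time cancel, leaving those of the distances
    between end points. Both signs of [x] and [y] are needed, since [gfbm] also reads [B] at
    negative times. *)
Lemma fbm_increment_has_mean_mul (x y h : R) :
  1 <= h -> `|x - y| = h ->
  has_mean P (fun w => (B (x + 1) w - B x w) * (B (y + 1) w - B y w))
    (2^-1 * ((h + 1) `^ (2 * H) - 2 * h `^ (2 * H) + (h - 1) `^ (2 * H))).
Proof.
move=> h1 xyh.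
have := has_mean_mul_lincomb 1 (-1) 1 (-1) (fbm_has_mean_mul (x + 1) (y + 1))
  (fbm_has_mean_mul (x + 1) y) (fbm_has_mean_mul x (y + 1))
  (fbm_has_mean_mul x y).
congr has_mean; first by apply/funext => w; ring.
rewrite /k (_ : x + 1 - (y + 1) = x - y); last by ring.
(* These distances are [h + 1] and [h - 1], in an order set by the sign of [x - y]; [1 <= h] ensures
   that [h - 1] is nonnegative. *)
have : `|x + 1 - y| `^ (2 * H) + `|x - (y + 1)| `^ (2 * H) =
    (h + 1) `^ (2 * H) + (h - 1) `^ (2 * H).
  have [xy0|xy0] := leP 0 (x - y).
    rewrite ger0_norm // in xyh.
    by congr (_ `^ _ + _ `^ _); rewrite ger0_norm -?xyh; lra.
  rewrite ltr0_norm // in xyh.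
  by rewrite addrC; congr (_ `^ _ + _ `^ _); rewrite ler0_norm -?xyh; lra.
by rewrite xyh; lra.
Qed.

Lemma R_Z_gfbm (a b : R) (n p : nat) : (1 <= n)%N ->
  R_Z P (gfbm a b B) p (p + n) =
    ((a ^+ 2 + b ^+ 2) * R_B H n
     - a * b * ((2 * p + n)%:R `^ (2 * H) - 2 * ((2 * p + n)%:R + 1) `^ (2 * H)
                + ((2 * p + n)%:R + 2) `^ (2 * H)))%:E.
Proof.
move=> n1; have n1R : (1 : R) <= n%:R by rewrite ler1n.
have p0 : 0 <= p%:R :> R by [].
have mE : (2 * p + n)%:R = 2 * p%:R + n%:R :> R by rewrite natrD natrM.
(* [m] is the lag in both cross terms, so the second difference sits at [m - 1], [m], [m + 1]. *)
pose m : R := (2 * p + n)%:R + 1.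
have m1 : 1 <= m by rewrite lerDr.
(* [B (- p.+1) - B (- p)] is minus the increment of [B] started at [- p - 1]. *)
have e1 : `|p%:R - (p%:R + n%:R)| = n%:R :> R by rewrite ler0_norm; lra.
have e2 : `|p%:R - (- (p%:R + n%:R) - 1)| = m :> R.
  by rewrite /m mE ger0_norm; lra.
have e3 : `|- p%:R - 1 - (p%:R + n%:R)| = m :> R.
  by rewrite /m mE ler0_norm; lra.
have e4 : `|- p%:R - 1 - (- (p%:R + n%:R) - 1)| = n%:R :> R.
  by rewrite ger0_norm; lra.
have [] := has_mean_mul_lincomb a (- b) a (- b)
  (fbm_increment_has_mean_mul n1R e1) (fbm_increment_has_mean_mul m1 e2)
  (fbm_increment_has_mean_mul m1 e3) (fbm_increment_has_mean_mul n1R e4).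
move=> _; rewrite /R_Z; set f := (f in expectation _ f) => Ef.
rewrite (_ : (_ \* _) = f); last first.
  apply/funext => w; rewrite /f /increment /gfbm/= !subrK -!natr1 !natrD.
  by rewrite !opprD; ring.
have m2E : m + 1 = (2 * p + n)%:R + 2 by rewrite /m; ring.
by rewrite {}Ef /R_B m2E /m addrK; congr EFin; field.
Qed.

End fbm_increments.

(** * Second differences of power functions *)

Section powR_asymptotics.
Context {R : realType}.

Lemma second_difference_powR (r x : R) : 0 < x ->
  exists2 c, x < c < x + 2 &
    x `^ r - 2 * (x + 1) `^ r + (x + 2) `^ r = r * (r - 1) * c `^ (r - 2).
Proof.
move=> x0.
have mvt (s y : R) : 0 < y ->
    exists2 c, y < c < y + 1 & (y + 1) `^ s - y `^ s = s * c `^ (s - 1).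
  move=> y0.
  have [|z||c] := @MVT R (fun z => z `^ s) (fun z => s * z `^ (s - 1))
    y (y + 1).
  - by rewrite ltrDl.
  - by rewrite in_itv/= => /andP[yz _]; apply: is_derive1_powR; lra.
  - apply: derivable_within_continuous => z; rewrite in_itv/= => /andP[yz _].
    by apply: ex_derive; apply: is_derive1_powR; lra.
  by rewrite in_itv/= => yc; rewrite addrAC subrr add0r mulr1; exists c.
have dg (z : R) : 0 < z -> is_derive z 1 (fun z : R => (z + 1) `^ r - z `^ r)
    (r * ((z + 1) `^ (r - 1) - z `^ (r - 1))).
  move=> z0; have z1 : 0 < z + 1 by lra.
  have dz1 : is_derive z 1 (fun z : R => z + 1) 1.
    by apply: is_derive_eq; rewrite addr0.
  have d1 := @is_derive1_comp R (fun z => z `^ r) (fun z : R => z + 1) z _ _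
    (is_derive1_powR r z1) dz1.
  rewrite /= mulr1 in d1.
  have d0 := is_derive1_powR r z0.
  by apply: is_derive_eq; rewrite -mulrBr.
(* The second difference is the increment over [[x, x + 1]] of the first difference. The derivative
   at the mean point [c] is again a unit difference, of the power [r - 1], to which [mvt] applies on
   [[c, c + 1]]. *)
have [|z||c] := @MVT R (fun z => (z + 1) `^ r - z `^ r)
    (fun z => r * ((z + 1) `^ (r - 1) - z `^ (r - 1))) x (x + 1).
- by rewrite ltrDl.
- by rewrite in_itv/= => /andP[xz _]; apply: dg; lra.
- apply: derivable_within_continuous => z; rewrite in_itv/= => /andP[xz _].
  by apply: ex_derive; apply: dg; lra.
rewrite in_itv/= => /andP[xc cx] gE.
have c0 : 0 < c by lra.
have [e /andP[ce ec] eE] := mvt (r - 1) c c0.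
exists e; first by apply/andP; split; lra.
have -> : r - 2 = r - 1 - 1 by ring.
rewrite -mulrA -eE.
transitivity (r * ((c + 1) `^ (r - 1) - c `^ (r - 1)) * (x + 1 - x));
  last by ring.
by rewrite -gE (_ : x + 1 + 1 = x + 2); ring.
Qed.

Lemma continuous_powR_at1 (r : R) : {for 1, continuous (fun z => z `^ r)}.
Proof.
apply/differentiable_continuous/derivable1_diffP/ex_derive.
exact: is_derive1_powR.
Qed.

Lemma cvg_invrn : (n%:R : R)^-1 @[n --> \oo] --> (0 : R).
Proof. by rewrite -cvg_shiftS; exact: cvg_harmonic. Qed.

(** A negative power of [n] is the positive power [- r] of [1 / n], and positive powers tend to 0 at
    0 from the right. The shift avoids [n = 0]. *)
Lemma cvg_natr_powR_lt0 (r : R) :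
  r < 0 -> (n%:R : R) `^ r @[n --> \oo] --> (0 : R).
Proof.
move=> r0; rewrite -cvg_shiftS.
have -> : (fun n => (n.+1%:R : R) `^ r) = (fun n => harmonic n `^ (- r)).
  by apply/funext => n; rewrite /harmonic/= -powR_inv1// -powRrM mulN1r opprK.
have /cvg_at_rightP : a `^ (- r) @[a --> (0 : R)^'+] --> 0.
  by apply: powR_cvg0; rewrite oppr_gt0.
by apply; split => [n|]; [exact: harmonic_gt0|exact: cvg_harmonic].
Qed.

Lemma second_difference_powR_asymptotic (r : R) (n : nat) :
  exists2 eps : R^nat, eps @ \oo --> (0 : R) &
    forall p : nat, (1 <= p)%N ->
      (2 * p + n)%:R `^ r - 2 * ((2 * p + n)%:R + 1) `^ r
        + ((2 * p + n)%:R + 2) `^ r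
      = r * (r - 1) * (2 * p%:R) `^ (r - 2) * (1 + eps p).
Proof.
have ex_mid (p : nat) : exists c : R, (1 <= p)%N ->
    (2 * p + n)%:R < c < (2 * p + n)%:R + 2 /\
    (2 * p + n)%:R `^ r - 2 * ((2 * p + n)%:R + 1) `^ r
        + ((2 * p + n)%:R + 2) `^ r = r * (r - 1) * c `^ (r - 2).
  (* [choice] wants a total function; at [p = 0] the guard is false and any value will do. *)
  case: p => [|p]; first by exists 0.
  have m0 : 0 < (2 * p.+1 + n)%:R :> R by rewrite ltr0n.
  by have [c cm cE] := second_difference_powR r m0; exists c.
have [c cE] := choice ex_mid.
pose q (p : nat) : R := c p / (2 * p%:R).
have q1 : q p @[p --> \oo] --> (1 : R).
  (* Divide [2p <= 2p + n < c p < 2p + n + 2] by [2p]. *)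
  apply: (@squeeze_cvgr _ _ _ _ (fun=> 1)
    (fun p => 1 + (n%:R + 2) / 2 * (p%:R)^-1)).
  - near=> p.
    have p1 : (1 <= p)%N by near: p; exact: nbhs_infty_ge.
    have p0 : 0 < p%:R :> R by rewrite ltr0n.
    have [/andP[] + + _] := cE p p1.
    rewrite natrD natrM => cl cu; have n0 : 0 <= n%:R :> R by [].
    rewrite /q ler_pdivlMr ?ler_pdivrMr ?mulr_gt0//.
    apply/andP; split; first lra.
    rewrite (_ : (1 + _) * _ = 2 * p%:R + n%:R + 2); first lra.
    by field; rewrite gt_eqF.
  - exact: cvg_cst.
  - rewrite -[X in _ --> X]addr0; apply: cvgD; first exact: cvg_cst.
    rewrite -[X in _ --> X](mulr0 ((n%:R + 2) / 2)).
    by apply: cvgMr; exact: cvg_invrn.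
exists (fun p => q p `^ (r - 2) - 1).
  rewrite -(subrr 1); apply: cvgB; last exact: cvg_cst.
  rewrite [X in _ --> X](_ : 1 = 1 `^ (r - 2)); last by rewrite powR1.
  exact: (continuous_cvg _ (@continuous_powR_at1 _) q1).
move=> p p1; have [/andP[cl cu] ->] := cE p p1.
have p0 : 0 < 2 * p%:R :> R by rewrite mulr_gt0// ltr0n.
have c0 : 0 < c p by rewrite (le_lt_trans _ cl).
rewrite subrKC -[RHS]mulrA -powRM ?divr_ge0 ?ltW//.
by rewrite mulrCA divff ?mulr1// gt_eqF.
Unshelve. all: by end_near. Qed.

End powR_asymptotics.

Theorem proposition2 (R : realType) (d : measure_display)
    (T : measurableType d) (P : probability T R)
    (H a b : R) (B : R -> {RV P >-> R})
    (H01 : 0 < H < 1) (ab0 : (a, b) <> (0, 0))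
    (fbmB : fractional_brownian_motion H B) :
  forall n : nat, (1 <= n)%N ->
    (exists2 eps : R^nat, eps @ \oo --> (0 : R) &
       forall p : nat, (1 <= p)%N ->
         R_Z P (gfbm a b B) p (p + n) =
         ((a ^+ 2 + b ^+ 2) * R_B H n
          - a * b * (2 `^ (2 * H - 1) * H * (2 * H - 1))
            * p%:R `^ (2 * (H - 1)) * (1 + eps p))%:E)
    /\ R_Z P (gfbm a b B) p (p + n) @[p --> \oo]
         --> ((a ^+ 2 + b ^+ 2) * R_B H n)%:E.
Proof.
move=> n n1.
have [eps eps0 epsE] := @second_difference_powR_asymptotic R (2 * H) n.
have RZE (p : nat) : (1 <= p)%N -> R_Z P (gfbm a b B) p (p + n) =
    ((a ^+ 2 + b ^+ 2) * R_B H n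
     - a * b * (2 `^ (2 * H - 1) * H * (2 * H - 1))
       * p%:R `^ (2 * (H - 1)) * (1 + eps p))%:E.
  move=> p1; rewrite (R_Z_gfbm fbmB)// epsE// powRM//; congr (_ - _)%:E.
  have -> : 2 * (H - 1) = 2 * H - 2 by ring.
  (* The factor 2 of [2 * H] and the power of 2 in [(2 * p) ^ (2H - 2)] combine into the stated
     constant. *)
  have -> : 2 `^ (2 * H - 1) = 2 * 2 `^ (2 * H - 2) :> R.
    rewrite (_ : 2 * H - 1 = 1 + (2 * H - 2)); last by ring.
    by rewrite powRD ?powRr1// pnatr_eq0 implybT.
  by ring.
split; first by exists eps.
(* [RZE] starts at [p = 1]: shift, substitute, then shift back. *)
rewrite -cvg_shiftS (eq_cvg _ _ (fun p => RZE p.+1 isT)).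
rewrite (cvg_shiftS (fun p => (_ - _ * p%:R `^ _ * (1 + eps p))%:E)).
apply: cvg_EFin; first exact: nearW.
rewrite -[X in _ --> X]subr0; apply: cvgB; first exact: cvg_cst.
rewrite -(mul0r (1 + 0 : R)); apply: cvgM; last first.
  by apply: cvgD => //; exact: cvg_cst.
rewrite -[X in _ --> X](mulr0 (a * b * (2 `^ (2 * H - 1) * H * (2 * H - 1)))).
(* The exponent [2 * (H - 1)] is negative because [H < 1]. *)
apply: cvgMr; apply: cvg_natr_powR_lt0.
by case/andP: H01 => _; lra.
Qed.
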